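(* Let $N$ be a Kunz nilsemigroup with atom set $A=\{p_1,\dots,p_k\}\subseteq\mathbb Z_m\setminus\{0\}$, and suppose $\dim F_N=k-1$ and $F_N$ is not contained in the boundary of $C(m;A)$. Then: (a) There is a unique inner Betti element $p\in N$, and $\mathsf Z_N(p)=\{z,z'\}$ has exactly two elements. (b) For any non-nil $q\in N$, there exist unique factorizations $w,w'\in\mathsf Z_N(q)$ such that $z\not\le w$ and $z'\not\le w'$, where $\le$ denotes the componentwise partial order on $\mathbb Z^k_{\ge0}$. Moreover, $w\ne w'$ if and only if $p$ divides $q$ in $N$ (i.e. $q=p+r$ for some $r\in N$). (c) For any staircase Kunz nilsemigroup $N'$ with atom set $A$ and $F_N\subseteq F_{N'}$, either (i) $z\not\le w$ for all non-nil $q\in N'$ and all $w\in\mathsf Z_{N'}(q)$, or (ii) $z'\not\le w$ for all non-nil $q\in N'$ and all $w\in\mathsf Z_{N'}(q)$.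
   Context: Kunz cone $\mathcal C_m\subseteq\mathbb R^{m-1}$ (coordinates indexed by nonzero residues of $\mathbb Z_m$, $x_0=0$): defined by $x_i+x_j\ge x_{i+j}$ for nonzero $i,j$ with $i+j\ne0$. A face $F$ has trivial Kunz subgroup if no $x_i$ ($i\ne0$) vanishes identically on $F$; its Kunz nilsemigroup is $\mathbb Z_m\cup\{\infty\}$ with nil $\infty$ and $a\oplus b=a+b$ if $x_a+x_b=x_{a+b}$ on all of $F$, $\infty$ otherwise. A Kunz nilsemigroup here means the Kunz nilsemigroup of such a face. Atoms: nonzero elements not a sum of two nonzero elements. $\mathsf Z_N(n)=\{z\in\mathbb Z^k_{\ge0}: z_1p_1\oplus\cdots\oplus z_kp_k=n\}$; $\bar z=\sum z_ip_i$ in $\mathbb Z_m$. $N$ is staircase if each non-nil element has exactly one factorization. An inner Betti element of $N$ is a non-nil $p\in N$ whose factorization graph (vertices $\mathsf Z_N(p)$, with $z,z'$ adjacent iff $\{i:z_i>0\}\cap\{i:z'_i>0\}\ne\emptyset$) is disconnected. With $\mathrm{supp}(z)=\{i:z_i>0\}$, $\mathrm{supp}(B)=\bigcup_{z\in B}\mathrm{supp}(z)$, $B-e_i=\{z-e_i:z\in B,z_i>0\}$, an outer Betti element is $B\subseteq\mathsf Z_N(\infty)$ with (i) for each $i\in\mathrm{supp}(B)$, $B-e_i=\mathsf Z_N(q)$ for some non-nil $q$, and (ii) the graph on $B$ joining elements with intersecting supports connected. $H_N\subseteq\mathbb R^k$: points with $c\cdot x=c'\cdot x$ for all $c,c'$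 in a common $\mathsf Z_N(q)$, $q$ non-nil. Betti inequality: $z\cdot x\ge a\cdot x$, $z$ in an outer Betti element, $a\in\mathsf Z_N(\bar z)$. $F_N$: points of $H_N$ satisfying all Betti inequalities. $C(m;A)=\{x\in\mathbb R^k_{\ge0}: x_i\le c\cdot x$ for all $i$ and all $c\in\mathbb Z^k_{\ge0}$ with $\sum c_jp_j\equiv p_i\bmod m\}$. *)

(* Defs.v *)
From mathcomp Require Import all_boot all_order all_algebra.
From mathcomp Require Import boolp classical_sets reals topology normedtype.

Set Implicit Arguments.
Unset Strict Implicit.
Unset Printing Implicit Defensive.

Import Order.TTheory GRing.Theory Num.Theory.
Import numFieldNormedType.Exports.

Local Open Scope classical_set_scope.
Local Open Scope ring_scope.

(** The ambient space [R^(m-1)], with coordinates indexed by the nonzero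
    residues, is realized as the functions [x : 'Z_m -> R] with [x 0 = 0];
    this is meaningful for [1 < m] only, since ['Z_0] and ['Z_1] are [Z/2]. *)
Definition kunz_cone (R : realType) (m : nat) : set ('Z_m -> R) :=
  [set x | x 0 = 0 /\
    forall i j : 'Z_m, i != 0 -> j != 0 -> i + j != 0 -> x (i + j) <= x i + x j].

Definition kunz_face (R : realType) (m : nat) (F : set ('Z_m -> R)) : Prop :=
  exists u : 'Z_m -> R,
    (forall x, kunz_cone x -> 0 <= \sum_(i : 'Z_m) u i * x i) /\
    F = [set x | kunz_cone x /\ \sum_(i : 'Z_m) u i * x i = 0].

Definition trivial_kunz_subgroup (R : realType) (m : nat)
    (F : set ('Z_m -> R)) : Prop :=
  forall i : 'Z_m, i != 0 -> exists2 x, F x & x i <> 0.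

(** [None] is the nil element. *)
Definition nilop (m : nat) : Type :=
  option 'Z_m -> option 'Z_m -> option 'Z_m.

Definition face_nilop (R : realType) (m : nat) (F : set ('Z_m -> R)) : nilop m :=
  fun s t => match s, t with
  | Some a, Some b =>
      if `[< forall x, F x -> x a + x b = x (a + b) >] then Some (a + b) else None
  | _, _ => None
  end.

Definition kunz_nilsemigroup (R : realType) (m : nat) (N : nilop m) : Prop :=
  exists F : set ('Z_m -> R),
    [/\ kunz_face F, trivial_kunz_subgroup F & N = face_nilop F].

Definition atom (m : nat) (N : nilop m) (n : option 'Z_m) : Prop :=
  n <> Some 0 /\
  forall s t, s <> Some 0 -> t <> Some 0 -> n <> N s t.

Definition atom_enum (m k : nat) (N : nilop m) (p : 'I_k -> 'Z_m) : Prop :=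
  injective p /\ forall n, atom N n <-> exists i, n = Some (p i).

Notation expo k := {ffun 'I_k -> nat}.

Definition expo_le (k : nat) (z w : expo k) : bool :=
  [forall i, (z i <= w i)%N].

Definition nilmul (m : nat) (N : nilop m) (n : nat) (a : 'Z_m) : option 'Z_m :=
  iter n (N (Some a)) (Some 0).

Definition nileval (m k : nat) (N : nilop m) (p : 'I_k -> 'Z_m) (z : expo k) :
    option 'Z_m :=
  \big[N/Some 0]_(i < k) nilmul N (z i) (p i).

Definition factorizations (m k : nat) (N : nilop m) (p : 'I_k -> 'Z_m)
    (n : option 'Z_m) : set (expo k) :=
  [set z | nileval N p z = n].

Definition zbar (m k : nat) (p : 'I_k -> 'Z_m) (z : expo k) : 'Z_m :=
  \sum_(i < k) p i *+ z i.

Definition staircase (m k : nat) (N : nilop m) (p : 'I_k -> 'Z_m) : Prop :=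
  forall q : 'Z_m, exists! z, factorizations N p (Some q) z.

Definition overlap (k : nat) (z w : expo k) : bool :=
  [exists i, (0 < z i)%N && (0 < w i)%N].

Definition support_connected (k : nat) (B : set (expo k)) : Prop :=
  forall z w, B z -> B w ->
    exists s : seq (expo k),
      [/\ path (@overlap k) z s, forall v, v \in s -> B v & last z s = w].

Definition inner_betti (m k : nat) (N : nilop m) (p : 'I_k -> 'Z_m) (q : 'Z_m) :
    Prop :=
  ~ support_connected (factorizations N p (Some q)).

Definition supp (k : nat) (B : set (expo k)) : set 'I_k :=
  [set i | exists2 z, B z & (0 < z i)%N].

Definition expo_decr (k : nat) (i : 'I_k) (z : expo k) : expo k :=
  [ffun j => (z j - (j == i))%N].

Definition set_decr (k : nat) (B : set (expo k)) (i : 'I_k) : set (expo k) :=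
  [set expo_decr i z | z in [set z | B z /\ (0 < z i)%N]].

Definition outer_betti (m k : nat) (N : nilop m) (p : 'I_k -> 'Z_m)
    (B : set (expo k)) : Prop :=
  [/\ B `<=` factorizations N p None,
      forall i, supp B i ->
        exists q : 'Z_m, set_decr B i = factorizations N p (Some q)
    & support_connected B].

Definition dot (R : realType) (k : nat) (c : expo k) (x : 'rV[R]_k) : R :=
  \sum_(i < k) (c i)%:R * x 0 i.

Definition HN (R : realType) (m k : nat) (N : nilop m) (p : 'I_k -> 'Z_m) :
    set 'rV[R]_k :=
  [set x : 'rV[R]_k | forall (q : 'Z_m) c c', factorizations N p (Some q) c ->
             factorizations N p (Some q) c' -> dot c x = dot c' x].

Definition FN (R : realType) (m k : nat) (N : nilop m) (p : 'I_k -> 'Z_m) :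
    set 'rV[R]_k :=
  [set x : 'rV[R]_k | HN N p x /\
    forall B z a, outer_betti N p B -> B z ->
      factorizations N p (Some (zbar p z)) a -> dot a x <= dot z x].

Definition CmA (R : realType) (m k : nat) (p : 'I_k -> 'Z_m) : set 'rV[R]_k :=
  [set x : 'rV[R]_k | (forall i, 0 <= x 0 i) /\
    forall i (c : expo k), zbar p c = p i -> x 0 i <= dot c x].

Definition boundary (T : topologicalType) (S : set T) : set T :=
  closure S `\` interior S.

(** The dimension of a cone, as the dimension of its linear span (which is also
    its affine hull, as a cone contains the origin). *)
Definition cone_dim (R : realType) (k : nat) (S : set 'rV[R]_k) (d : nat) : Prop :=
  exists U : {vspace 'rV[R]_k},
    [/\ forall x, S x -> x \in U,
        forall V : {vspace 'rV[R]_k}, (forall x, S x -> x \in V) -> (U <= V)%VS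
      & \dim U = d].

(* Main.v *)
From HB Require Import structures.
Require Import Defs.
From mathcomp Require Import all_boot all_order all_algebra.
From mathcomp Require Import boolp classical_sets reals topology normedtype.
From mathcomp Require Import zify ring lra.

Import Order.TTheory GRing.Theory Num.Theory.
Import numFieldNormedType.Exports.

Local Open Scope classical_set_scope.
Local Open Scope ring_scope.

(** The operation of [N] is already determined by a single point [xi] in the
    relative interior of its face, so that [z] is a factorization of a non-nil
    [q] iff [zbar z = q] and [dot z (xi o p) = xi q]. Both conditions are additive,
    hence factorizations can be exchanged and cancelled. If all factorizations
    were unique, every point near [xi o p] would lie in [FN], against
    [dim FN = k - 1]. As [FN] spans a hyperplane on which all differences of
    factorizations of the same element vanish, these differences are pairwise
    proportional. A pair [z, z'] of distinct factorizations of the same element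
    [b], of minimal total degree, has disjoint supports, and all differences are
    integer multiples of [z - z']: the factorizations of any [q] form a chain
    along [z - z'], which gives (a) and (b). For (c), if [z] and [z'] both divide
    non-nil elements of a staircase [N'], they factor the same element of [N'],
    so [z = z']. *)

(** * Generic points of faces *)

(** The singleton [[set xi]] turns identities on a whole face into equations between numbers.
    Subadditivity is imposed for all residues, also for [i + j = 0], where the cone has no
    inequality. *)
Definition generic_point {R : realType} {m : nat} (N : nilop m) (xi : 'Z_m -> R) : Prop :=
  [/\ xi 0 = 0, forall i, i != 0 -> 0 < xi i,
      forall i j, xi (i + j) <= xi i + xi j
    & N = face_nilop [set xi]].

(** Look at a smallest coordinate [i0]. If [i0 + i0] is nonzero, doubling gives
    [x i0 <= x (i0 + i0) <= 2 * x i0]. Otherwise [m > 2] leaves a third residue [j], and going from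
    [j] to [j + i0] and back to [j] gives [0 <= 2 * x i0]. *)
Lemma kunz_cone_ge0 {R : realType} {m : nat} (x : 'Z_m -> R) (i : 'Z_m) :
  (2 < m)%N -> kunz_cone x -> 0 <= x i.
Proof.
case: m x i => [|[|[|m]]] //= x i _ [x0 xD].
pose i0 := [arg min_(j < i) x j]%O.
have i0P j : x i0 <= x j by rewrite /i0; case: arg_minP => // t _; apply.
apply: le_trans (i0P i).
have [->|i0n0] := eqVneq i0 0; first by rewrite x0.
have [dbl0|dbln0] := eqVneq (i0 + i0) 0; last first.
  by have := xD _ _ i0n0 i0n0 dbln0; have := i0P (i0 + i0); lra.
have [j jn0 jni0] : exists2 j : 'Z_m.+3, j != 0 & j != i0.
  have [e|e] := eqVneq i0 1; last by exists 1; rewrite // eq_sym.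
  by exists (inZp 2); rewrite ?e.
have e1 : j + i0 != 0.
  by apply: contraNneq jni0 => e; rewrite -(addrK i0 j) e sub0r -(addr0 (- i0)) -dbl0 addKr.
have e2 : j + i0 + i0 = j by rewrite -addrA dbl0 addr0.
have := xD _ _ jn0 i0n0 e1.
by have := xD _ _ e1 i0n0; rewrite e2 => /(_ jn0); lra.
Qed.

Lemma kunz_cone0 {R : realType} {m : nat} : @kunz_cone R m (fun=> 0).
Proof. by split=> // *; rewrite addr0. Qed.

Lemma kunz_coneD {R : realType} {m : nat} (x y : 'Z_m -> R) :
  kunz_cone x -> kunz_cone y -> kunz_cone (fun i => x i + y i).
Proof.
move=> [x0 xD] [y0 yD]; split=> [|i j i0 j0 ij0]; first by rewrite x0 y0 addr0.
by have := xD i j i0 j0 ij0; have := yD i j i0 j0 ij0; lra.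
Qed.

Lemma kunz_face0 {R : realType} {m : nat} (F : set ('Z_m -> R)) :
  kunz_face F -> F (fun=> 0).
Proof.
case=> u [_ ->]; split; first exact: kunz_cone0.
by apply: big1 => i _; rewrite mulr0.
Qed.

Lemma kunz_face_sum {R : realType} {m : nat} (F : set ('Z_m -> R))
    (I : finType) (f : I -> 'Z_m -> R) :
  kunz_face F -> (forall t, F (f t)) -> F (fun i => \sum_t f t i).
Proof.
move=> Fface Ff.
suff H (s : seq I) : F (fun i => \sum_(t <- s) f t i) by apply: H.
elim: s => [|t s IHs].
  by rewrite (_ : (fun=> _) = fun=> 0) ?funeqE => [|i]; rewrite ?big_nil //; apply: kunz_face0.
rewrite (_ : (fun=> _) = fun i => f t i + \sum_(t <- s) f t i); last first.
  by apply/funext => i; rewrite big_cons.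
move: IHs; have := Ff t; case: Fface => u [_ ->] [c1 e1] [c2 e2].
split; first exact: kunz_coneD.
by under eq_bigr do rewrite mulrDr; rewrite big_split /= e1 e2 addr0.
Qed.

(** Sum finitely many points of the face: one for each pair whose inequality is strict somewhere,
    and one for each nonzero coordinate. Every summand satisfies all inequalities weakly, so the sum
    is strict wherever some point of the face is. *)
Lemma exists_generic_point {R : realType} {m : nat} (N : nilop m) :
  (1 < m)%N -> kunz_nilsemigroup R N -> exists xi : 'Z_m -> R, generic_point N xi.
Proof.
move=> m_gt1 [F [Fface Ftriv ->]].
have Fcone x : F x -> kunz_cone x by case: Fface => u [_ ->] [].
(* For [m = 2] the cone is the whole line, and the face need not be nonnegative. *)
have [m_gt2|m_le2] := ltnP 2 m; last first.
  have {m_le2} m2 : m = 2%N by lia.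
  subst m; exists (fun i => (i != 0)%:R); split.
  - by rewrite eqxx.
  - by move=> i ->; rewrite ltr01.
  - move=> i j; have [->|] := eqVneq i 0; first by rewrite !add0r.
    by move=> _; do 2?case: eqP => _ /=; lra.
  have x1 (a : 'Z_2) : a != 0 -> a = 1 by case: a => [[|[|n]] a] // _; apply: val_inj.
  apply/funext => s; apply/funext => t; case: s t => [a|] [b|] //=.
  congr (if _ then _ else _); apply: asbool_equiv_eq.
  have [->|/x1 a1] := eqVneq a 0.
    split=> _ x; last by case/Fcone => -> _; rewrite !add0r.
    by move=> ->; rewrite eqxx !add0r.
  have [->|/x1 b1] := eqVneq b 0.
    split=> _ x; last by case/Fcone => -> _; rewrite !addr0.
    by move=> ->; rewrite eqxx !addr0.
  (* Coordinate [1] does not vanish on the face, so [1 + 1] is nil in both descriptions. *)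
  subst a b; have e11 : 1 + 1 = 0 :> 'Z_2 by apply: val_inj.
  rewrite e11; split=> H; last by have /eqP := H _ erefl; rewrite eqxx -mulr2n pnatr_eq0.
  have [x Fx] := Ftriv 1 isT.
  by have := H x Fx; case: (Fcone x Fx) => -> _ ? []; lra.
have F_ge0 x i : F x -> 0 <= x i by move=> /Fcone; apply: kunz_cone_ge0.
have FD x i j : F x -> x (i + j) <= x i + x j.
  move=> Fx; have [x0 xD] := Fcone x Fx.
  have [->|i0] := eqVneq i 0; first by rewrite x0 !add0r.
  have [->|j0] := eqVneq j 0; first by rewrite x0 !addr0.
  have [->|ij0] := eqVneq (i + j) 0; last exact: xD.
  by rewrite x0 addr_ge0 // F_ge0.
have /choice[f fP] (t : 'Z_m * 'Z_m) : exists x, F x /\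
    ((exists2 y, F y & y (t.1 + t.2) <> y t.1 + y t.2) -> x (t.1 + t.2) < x t.1 + x t.2).
  have [[y Fy yP]|nP] := pselect (exists2 y, F y & y (t.1 + t.2) <> y t.1 + y t.2).
    by exists y; split=> // _; rewrite lt_neqAle FD // andbT; apply/eqP.
  (* Default for a pair whose inequality is an equality on all of [F]. *)
  by exists (fun=> 0); split=> //; apply: kunz_face0.
have /choice[g gP] (i : 'Z_m) : exists x, F x /\ (i != 0 -> 0 < x i).
  have [->|i0] := eqVneq i 0; first by exists (fun=> 0); split=> //; apply: kunz_face0.
  have [x Fx x0] := Ftriv i i0.
  by exists x; split=> // _; rewrite lt_neqAle F_ge0 // andbT eq_sym; apply/eqP.
pose h (t : ('Z_m * 'Z_m) + 'Z_m) := match t with inl u => f u | inr i => g i end.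
have Fh t : F (h t) by case: t => u; [case: (fP u) | case: (gP u)].
have Fxi := kunz_face_sum F _ h Fface Fh.
exists (fun i => \sum_t h t i); split.
- by have [] := Fcone _ Fxi.
- move=> i i0; rewrite (bigD1 (inr i)) //= ltr_pwDl //; first by case: (gP i) => _; apply.
  by apply: sumr_ge0 => t _; apply: F_ge0.
- by move=> i j; apply: FD Fxi.
apply/funext => s; apply/funext => t; case: s t => [a|] [b|] //=.
congr (if _ then _ else _); apply: asbool_equiv_eq; split=> [H x ->|/(_ _ erefl) H x Fx].
  exact: H _ Fxi.
apply/eqP; case: eqP => // /nesym nE.
have := (fP (a, b)).2 (ex_intro2 _ _ x Fx nE) => /= lt_f.
suff : \sum_t h t (a + b) < \sum_t h t a + \sum_t h t b by rewrite H ltxx.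
rewrite -big_split (bigD1 (inl (a, b))) //= [ltRHS](bigD1 (inl (a, b))) //=.
by rewrite ltr_leD // ler_sum // => t _; apply: FD.
Qed.

(** * Exponent vectors *)

Definition expo_unit {k : nat} (i : 'I_k) : expo k := [ffun j => (j == i) : nat].

Lemma expo_addE {k : nat} (c d : expo k) (i : 'I_k) : (c + d) i = (c i + d i)%N.
Proof. by rewrite ffunE. Qed.

Lemma expo_leP {k : nat} (z c : expo k) :
  reflect (exists g : expo k, c = g + z) (expo_le z c).
Proof.
apply: (iffP forallP) => [zc|[g ->] i]; last by rewrite ffunE leq_addl.
exists [ffun i => (c i - z i)%N]; apply/ffunP => i.
by rewrite !ffunE; apply/esym/subnK/zc.
Qed.

Lemma expo_le_unit {k : nat} (z : expo k) (i : 'I_k) :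
  expo_le (expo_unit i) z = (0 < z i)%N.
Proof.
apply/forallP/idP => [/(_ i)|zi j]; rewrite !ffunE ?eqxx //.
by case: eqP => // ->.
Qed.

Lemma dot0 {R : realType} {k : nat} (x : 'rV[R]_k) : dot 0 x = 0.
Proof. by apply: big1 => i _; rewrite ffunE mul0r. Qed.

Lemma dotD {R : realType} {k : nat} (c d : expo k) (x : 'rV[R]_k) :
  dot (c + d) x = dot c x + dot d x.
Proof. by rewrite -big_split; apply: eq_bigr => i _; rewrite ffunE natrD mulrDl. Qed.

Lemma dot_unit {R : realType} {k : nat} (i : 'I_k) (x : 'rV[R]_k) :
  dot (expo_unit i) x = x 0 i.
Proof.
rewrite /dot (bigD1 i) //= ffunE eqxx mul1r big1 ?addr0 // => j /negbTE ji.
by rewrite ffunE ji mul0r.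
Qed.

Lemma dot_addr {R : realType} {k : nat} (c : expo k) (x h : 'rV[R]_k) (a : R) :
  dot c (x + a *: h) = dot c x + a * dot c h.
Proof.
rewrite /dot mulr_sumr -big_split; apply: eq_bigr => i _ /=.
by rewrite !mxE mulrDr mulrCA.
Qed.

Lemma zbar0 {m k : nat} (p : 'I_k -> 'Z_m) : zbar p 0 = 0.
Proof. by apply: big1 => i _; rewrite ffunE mulr0n. Qed.

Lemma zbarD {m k : nat} (p : 'I_k -> 'Z_m) (c d : expo k) :
  zbar p (c + d) = zbar p c + zbar p d.
Proof. by rewrite -big_split; apply: eq_bigr => i _; rewrite ffunE mulrnDr. Qed.

Lemma zbar_unit {m k : nat} (p : 'I_k -> 'Z_m) (i : 'I_k) : zbar p (expo_unit i) = p i.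
Proof.
rewrite /zbar (bigD1 i) //= ffunE eqxx mulr1n big1 ?addr0 // => j /negbTE ji.
by rewrite ffunE ji mulr0n.
Qed.

(** * Factorizations through a generic point *)

Section Factorizations.
Context {R : realType} {m k : nat} {N : nilop m} {p : 'I_k -> 'Z_m} {xi : 'Z_m -> R}.
Hypothesis xiN : generic_point N xi.

Let x0 : 'rV[R]_k := \row_i xi (p i).

Lemma generic_ge0 a : 0 <= xi a.
Proof.
by case: xiN => xi0 xi_gt0 _ _; have [->|/xi_gt0/ltW] := eqVneq a 0; rewrite ?xi0.
Qed.

Lemma generic_nilop a b :
  N (Some a) (Some b) = if xi a + xi b == xi (a + b) then Some (a + b) else None.
Proof.
case: xiN => _ _ _ -> /=; congr (if _ then _ else _).
by apply/asboolP/eqP => [/(_ _ erefl)|e x ->].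
Qed.

Lemma generic_nilop_Some s t q : N s t = Some q <->
  exists a b, [/\ s = Some a, t = Some b, a + b = q & xi a + xi b = xi q].
Proof.
split=> [|[a [b [-> -> <- e]]]]; last by rewrite generic_nilop e eqxx.
case: s t => [a|] [b|]; try by case: xiN => _ _ _ ->.
by rewrite generic_nilop; case: eqP => // e [<-]; exists a, b.
Qed.

(* A weight [w] bounds [xi q] from above, with equality exactly on the non-nil
   elements; this invariant is preserved by the nilsemigroup operation. *)
Let tracks (s : option 'Z_m) (q : 'Z_m) (w : R) : Prop :=
  xi q <= w /\ s = if w == xi q then Some q else None.

Let tracks0 : tracks (Some 0) 0 0.
Proof. by case: xiN => e _ _ _; rewrite /tracks e eqxx. Qed.

Let tracksD s q w t r v : tracks s q w -> tracks t r v -> tracks (N s t) (q + r) (w + v).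
Proof.
case: xiN => _ _ xiD _ [qw ->] [rv ->].
have := xiD q r => qr; split; first by lra.
case: (eqVneq w (xi q)) => [->|wq]; case: (eqVneq v (xi r)) => [->|vr].
- by rewrite generic_nilop.
all: case: eqP => [?|_]; last by case: xiN => _ _ _ ->.
- by case/eqP: vr; lra.
- by case/eqP: wq; lra.
- by case/eqP: vr; lra.
Qed.

Lemma nileval_generic z :
  xi (zbar p z) <= dot z x0 /\
  nileval N p z = if dot z x0 == xi (zbar p z) then Some (zbar p z) else None.
Proof.
rewrite -/(tracks _ _ _) /nileval /zbar /dot.
apply: (big_ind3 tracks) => [||i _]; first exact: tracks0.
  by move=> *; apply: tracksD.
rewrite mxE mulr_natl /nilmul.
elim: (z i) => [|n IHn]; first exact: tracks0.
rewrite iterS !mulrS; apply: tracksD => //.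
by rewrite /tracks eqxx.
Qed.

Lemma factorizationsP q z :
  factorizations N p (Some q) z <-> zbar p z = q /\ dot z x0 = xi q.
Proof.
rewrite /factorizations /= (nileval_generic z).2.
case: eqP => [e|ne]; first by split=> [[<-] | [-> _]].
by split=> // -[<-].
Qed.

Lemma factorizations_nil z :
  factorizations N p None z <-> xi (zbar p z) < dot z x0.
Proof.
have [le_w] := nileval_generic z; rewrite /factorizations /= => ->.
by rewrite lt_neqAle le_w andbT eq_sym; case: eqP.
Qed.

Lemma factorizations_zbar {q z} :
  factorizations N p (Some q) z -> factorizations N p (Some (zbar p z)) z.
Proof. by case/factorizationsP => e w; apply/factorizationsP; rewrite e. Qed.

(** Weight minus [xi] of the residue is nonnegative for [c] and for [d]. By subadditivity these two
    excesses add up to at most the excess of [c + d], which is [0]. *)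
Lemma factorizations_divisor {q c d} :
  factorizations N p (Some q) (c + d) -> factorizations N p (Some (zbar p c)) c.
Proof.
case/factorizationsP; rewrite zbarD dotD => e w; apply/factorizationsP; split=> //.
case: xiN => _ _ xiD _; have := xiD (zbar p c) (zbar p d); rewrite e -w.
by have := (nileval_generic c).1; have := (nileval_generic d).1; lra.
Qed.

Lemma factorizations_swap {q r c c' d} :
  factorizations N p (Some q) (c + d) -> factorizations N p (Some r) c ->
  factorizations N p (Some r) c' -> factorizations N p (Some q) (c' + d).
Proof.
rewrite !factorizationsP !zbarD !dotD => -[e w] [e1 w1] [e2 w2].
by split; [rewrite -e e2 e1 | rewrite -w w2 w1].
Qed.

Lemma factorizations_cancel {q r c c' d d'} :
  factorizations N p (Some q) (c + d) -> factorizations N p (Some q) (c' + d') ->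
  factorizations N p (Some r) d -> factorizations N p (Some r) d' ->
  exists s, factorizations N p (Some s) c /\ factorizations N p (Some s) c'.
Proof.
move=> cd c'd' rd rd'; exists (zbar p c); have := factorizations_divisor cd.
move: cd c'd' rd rd'; rewrite !factorizationsP !zbarD !dotD.
move=> [e1 w1] [e2 w2] [e3 w3] [e4 w4] [_ <-]; split=> //; split.
  by apply: (addIr r); rewrite -{1}e4 -e3 e1.
by apply: (addIr (xi r)); rewrite -{1}w4 -w3 w1.
Qed.

Lemma factorizations_eq0 {q z} : factorizations N p (Some q) z ->
  (forall i, p i != 0) -> q = 0 -> z = 0.
Proof.
move=> /factorizationsP[_ w] p0 q0; case: xiN => xi0 xi_gt0 _ _.
move: w; rewrite q0 xi0 => /eqP; rewrite psumr_eq0 => [/allP z0|i _]; last first.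
  by rewrite mxE mulr_ge0 // generic_ge0.
apply/ffunP => i; have := z0 i (mem_index_enum _).
by rewrite mxE mulf_eq0 (gt_eqF (xi_gt0 _ (p0 i))) orbF pnatr_eq0 ffunE => /eqP.
Qed.

Lemma atom_enum_neq0 : atom_enum N p -> forall i, p i != 0.
Proof.
move=> [_ pA] i; have [+ _] := (pA (Some (p i))).2 (ex_intro _ i erefl).
by move=> H; apply/eqP => e; rewrite e in H.
Qed.

Lemma factorizations_unit i : factorizations N p (Some (p i)) (expo_unit i).
Proof. by apply/factorizationsP; rewrite zbar_unit dot_unit mxE. Qed.

(** Induction on the number of residues with smaller [xi]: a nonzero non-atom splits as [a + b] with
    [xi a + xi b = xi q] and both terms positive, hence both smaller than [xi q]. *)
Lemma exists_factorization q : atom_enum N p -> exists z, factorizations N p (Some q) z.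
Proof.
move=> [_ pA].
have [n] := ubnP #|[pred r | xi r < xi q]|; elim: n q => // n IHn q qn.
have [->|q0] := eqVneq q 0.
  by exists 0; apply/factorizationsP; rewrite zbar0 dot0; case: xiN => ->.
have [/pA[i [->]]|nA] := pselect (atom N (Some q)).
  by exists (expo_unit i); apply: factorizations_unit.
have [s [t [s0 t0 /esym/generic_nilop_Some[a [b [sa tb ab xab]]]]]] :
    exists s t, [/\ s <> Some 0, t <> Some 0 & Some q = N s t].
  apply: contrapT => H; apply: nA; split=> [[/eqP]|s t s0 t0 e].
    by rewrite (negbTE q0).
  by apply: H; exists s, t.
have xi_gt0 : forall i, i != 0 -> 0 < xi i by case: xiN.
have a_gt0 : 0 < xi a by apply: xi_gt0; apply/eqP => a0; case: s0; rewrite sa a0.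
have b_gt0 : 0 < xi b by apply: xi_gt0; apply/eqP => b0; case: t0; rewrite tb b0.
have smaller c : xi c < xi q -> (#|[pred r | (xi r < xi c)%R]| < n)%N.
  move=> cq; apply: leq_trans (qn : (#|_| <= n)%N); apply: proper_card.
  apply/properP; split; last by exists c; rewrite !inE ?ltxx.
  by apply/fintype.subsetP => r; rewrite !inE => /lt_trans; apply.
have [|za] := IHn a; first by apply: smaller; lra.
have [|zb] := IHn b; first by apply: smaller; lra.
move=> /factorizationsP[eb wb] /factorizationsP[ea wa].
by exists (za + zb); apply/factorizationsP; rewrite zbarD dotD ea eb wa wb.
Qed.

Lemma staircase_unique {q r c c'} : staircase N p ->
  factorizations N p (Some q) c -> factorizations N p (Some r) c' ->
  zbar p c = zbar p c' -> c = c'.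
Proof.
move=> st /factorizations_zbar Zc /factorizations_zbar Zc' e.
by rewrite -e in Zc'; have [w [_ uw]] := st (zbar p c); rewrite -(uw c) // -(uw c').
Qed.

End Factorizations.

(** * Consequences of the dimension: two factorizations, proportional differences *)

(** The step is the reciprocal of [M], one plus the sum of all ratios [|D t| / slack t], which
    dominates each of them. *)
Lemma common_step {R : realType} {T : finType} (slack D : T -> R) :
  exists2 a : R, 0 < a & forall t, 0 < slack t -> a * D t <= slack t.
Proof.
pose M := 1 + \sum_(t | 0 < slack t) `|D t| / slack t.
have M_ge1 : 1 <= M.
  by rewrite lerDl sumr_ge0 // => t t0; rewrite divr_ge0 // ltW.
have M_gt0 : 0 < M by lra.
exists M^-1 => [|t t0]; first by rewrite invr_gt0.
rewrite mulrC ler_pdivrMr // -ler_pdivrMl // mulrC.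
apply: (@le_trans _ _ (`|D t| / slack t)).
  by rewrite ler_wpM2r ?invr_ge0 ?ler_norm // ltW.
rewrite /M (bigD1 t) //=.
have : 0 <= \sum_(i | (0 < slack i) && (i != t)) `|D i| / slack i.
  by rewrite sumr_ge0 // => i /andP[i0 _]; rewrite divr_ge0 // ltW.
lra.
Qed.

(** With unique factorizations [phi], the equations of [HN] are trivial, and each Betti inequality
    compares [e_i + phi q] with [phi (p i + q)]. There are thus finitely many of them, and all are
    strict at the base point because [z] is nil. *)
Lemma FN_nbhs_generic {R : realType} {m k : nat} {N : nilop m} {p : 'I_k -> 'Z_m}
    {xi : 'Z_m -> R} (h : 'rV[R]_k) :
  generic_point N xi -> staircase N p ->
  exists2 a, 0 < a & FN N p (\row_i xi (p i) + a *: h).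
Proof.
move=> xiN st.
have /choice[phi phiP] q : exists z, factorizations N p (Some q) z.
  by have [z []] := st q; exists z.
pose slack (t : 'I_k * 'Z_m) := xi (p t.1) + xi t.2 - xi (p t.1 + t.2).
pose D (t : 'I_k * 'Z_m) := dot (phi (p t.1 + t.2)) h - (h 0 t.1 + dot (phi t.2) h).
have [a a_gt0 aP] := common_step slack D.
exists a => //; split=> [q c c' cq c'q|B z c [Bnil Bdecr _] Bz cz].
  rewrite (staircase_unique xiN st cq c'q) //.
  by move: cq c'q; rewrite !(factorizationsP xiN) => -[-> _] [-> _].
have := Bnil z Bz; rewrite (factorizations_nil xiN) => z_nil.
(* The zero vector evaluates to [0], so the nil vector [z] has nonempty support. *)
have [i zi] : exists i, (0 < z i)%N.
  apply/existsP; apply: contraT => /existsPn z0; move: z_nil.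
  have -> : z = 0 by apply/ffunP => i; rewrite ffunE; have := z0 i; rewrite -eqn0Ngt => /eqP.
  by rewrite zbar0 dot0; case: xiN => ->; rewrite ltxx.
have [q qP] := Bdecr i (ex_intro2 _ _ z Bz zi).
have z_decr : z = expo_unit i + expo_decr i z.
  by apply/ffunP => j; rewrite !ffunE; case: eqP => [->|_]; [exact/esym/subnKC | rewrite add0r subn0].
have decr_q : factorizations N p (Some q) (expo_decr i z) by rewrite -qP; exists z.
have decr_phi : expo_decr i z = phi q.
  apply: (staircase_unique xiN st decr_q (phiP q)).
  by move: decr_q (phiP q); rewrite !(factorizationsP xiN) => -[-> _] [-> _].
have z_bar : zbar p z = p i + q.
  by rewrite z_decr zbarD zbar_unit; move/(factorizationsP xiN): decr_q => [->].
have c_phi : c = phi (p i + q).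
  apply: (staircase_unique xiN st cz (phiP _)).
  by move: cz (phiP (p i + q)); rewrite !(factorizationsP xiN) z_bar => -[-> _] [-> _].
move: z_nil; rewrite z_bar c_phi z_decr decr_phi !dotD !dot_unit !dot_addr !mxE.
have [_ ->] := (factorizationsP xiN _ _).1 (phiP (p i + q)).
have [_ ->] := (factorizationsP xiN _ _).1 (phiP q).
move=> z_nil.
by have := aP (i, q); rewrite /slack /D /= => /(_ ltac:(lra)); lra.
Qed.

Lemma exists_two_factorizations {R : realType} {m k d : nat} {N : nilop m}
    {p : 'I_k -> 'Z_m} {xi : 'Z_m -> R} :
  generic_point N xi -> atom_enum N p -> cone_dim (FN (R := R) N p) d -> (d < k)%N ->
  exists q c c', [/\ factorizations N p (Some q) c, factorizations N p (Some q) c' & c <> c'].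
Proof.
move=> xiN pA [U [FU _ dimU]] dk; apply: contrapT => nE.
have st : staircase N p.
  move=> q; have [z zq] := exists_factorization xiN q pA.
  by exists z; split=> // w wq; apply: contrapT => zw; apply: nE; exists q, z, w.
(* Direction [0] puts the base point itself in [U]; subtracting it from the perturbed points then
   puts every [h] in [U]. *)
have xU : \row_i xi (p i) \in U.
  have [a _ /FU] := FN_nbhs_generic 0 xiN st.
  by rewrite scaler0 addr0.
have : \dim U = k.
  have -> : U = fullv.
    apply/vspaceP => h; rewrite memvf.
    have [a a_gt0 /FU] := FN_nbhs_generic h xiN st.
    by rewrite rpredDl // rpredZeq (gt_eqF a_gt0).
  by rewrite dimvf /dim /= mul1n.
by rewrite dimU => e; rewrite e ltnn in dk.
Qed.

(* Two functionals vanishing on a hyperplane are proportional: otherwise some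
   coordinate plane would meet it trivially. *)
Lemma hyperplane_minors {R : fieldType} {k : nat} {U : {vspace 'rV[R]_k}}
    {u v : 'I_k -> R} :
  ((\dim U).+1 = k)%N ->
  (forall x, x \in U -> \sum_i u i * x 0 i = 0) ->
  (forall x, x \in U -> \sum_i v i * x 0 i = 0) ->
  forall i j, u i * v j = u j * v i.
Proof.
move=> dimU uU vU i j; apply/eqP; apply: contraT => minor.
have ij : j != i by apply: contraNneq minor => ->.
pose e (i : 'I_k) : 'rV[R]_k := delta_mx 0 i.
have sum_e (w : 'I_k -> R) a b : \sum_l w l * (a *: e i + b *: e j) 0 l = a * w i + b * w j.
  rewrite (bigD1 i) //= (bigD1 j) //= big1 => [|l /andP[/negbTE li /negbTE lj]].
    by rewrite !mxE !eqxx (negbTE ij) [i == j]eq_sym (negbTE ij) /=; ring.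
  by rewrite !mxE li lj /=; ring.
(* The minor is the determinant of the two functionals on the plane spanned by [e i] and [e j], so
   that plane meets [U] only in [0]. *)
have disj a b : a *: e i + b *: e j \in U -> a = 0 /\ b = 0.
  move=> abU; have := uU _ abU; have := vU _ abU; rewrite !sum_e => ev eu.
  have m0 : u i * v j - u j * v i != 0 by rewrite subr_eq0.
  split; apply: (mulIf m0); rewrite mul0r.
    transitivity (v j * (a * u i + b * u j) - u j * (a * v i + b * v j)); first by ring.
    by rewrite ev eu; ring.
  transitivity (u i * (a * v i + b * v j) - v i * (a * u i + b * u j)); first by ring.
  by rewrite ev eu; ring.
have eiP a : a *: e i \in U -> a = 0.
  by move=> aU; have [] := disj a 0; rewrite ?scale0r ?addr0.
have ei0 : e i != 0.
  by apply/eqP => /rowP/(_ i)/eqP; rewrite !mxE !eqxx oner_eq0.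
have ej0 : e j != 0.
  by apply/eqP => /rowP/(_ j)/eqP; rewrite !mxE !eqxx oner_eq0.
have cap1 : (U :&: <[e i]> = 0)%VS.
  apply/eqP; rewrite -subv0; apply/subvP => x; rewrite memv_cap => /andP[xU /vlineP[a ax]].
  by move: xU; rewrite ax => /eiP ->; rewrite scale0r mem0v.
have cap2 : ((U + <[e i]>) :&: <[e j]> = 0)%VS.
  apply/eqP; rewrite -subv0; apply/subvP => x; rewrite memv_cap => /andP[].
  move=> /memv_addP[y yU [_ /vlineP[a ->] ->]] /vlineP[b yb].
  have : (- a) *: e i + b *: e j \in U by rewrite -yb scaleNr addrC addrK.
  by case/disj => _ b0; rewrite yb b0 scale0r mem0v.
(* The direct sum has dimension [\dim U + 2 = k + 1], too large for the ambient space. *)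
have := dimvS (subvf (U + <[e i]> + <[e j]>)).
rewrite (dimv_disjoint_sum cap2) (dimv_disjoint_sum cap1) !dim_vline ei0 ej0.
by rewrite dimvf /dim /= mul1n; lia.
Qed.

Lemma factorizations_proportional {R : realType} {m k d : nat} {N : nilop m}
    {p : 'I_k -> 'Z_m} {q r : 'Z_m} {c c' e e' : expo k} :
  cone_dim (FN (R := R) N p) d -> d.+1 = k ->
  factorizations N p (Some q) c -> factorizations N p (Some q) c' ->
  factorizations N p (Some r) e -> factorizations N p (Some r) e' ->
  forall i j, ((c i)%:Z - (c' i)%:Z) * ((e j)%:Z - (e' j)%:Z) =
              ((c j)%:Z - (c' j)%:Z) * ((e i)%:Z - (e' i)%:Z).
Proof.
move=> [U [FU Umin dimU]] dk cq c'q er e'r i j.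
have vanish s w w' : factorizations N p (Some s) w -> factorizations N p (Some s) w' ->
    forall x, x \in U -> \sum_l ((w l)%:R - (w' l)%:R) * x 0 l = 0.
  move=> ws w's x xU.
  (* The kernel of this functional is a subspace containing [FN], so it contains the span [U]. *)
  pose f (x : 'rV[R]_k) : R^o := \sum_l ((w l)%:R - (w' l)%:R) * x 0 l.
  have f_lin : linear f.
    move=> a y z; rewrite /f scaler_sumr -big_split; apply: eq_bigr => l _ /=.
    by rewrite !mxE /GRing.scale /=; ring.
  pose fL : {linear _ -> _} := HB.pack f (GRing.isLinear.Build _ _ _ _ f f_lin).
  have : x \in lker (linfun fL).
    apply: (subvP (Umin _ _)) xU => y [yH _]; rewrite memv_ker lfunE /= /f.
    apply/eqP; transitivity (dot w y - dot w' y); last by rewrite (yH s w w') // subrr.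
    by rewrite /dot -sumrB; apply: eq_bigr => l _; rewrite mulrBl.
  by rewrite memv_ker lfunE => /eqP.
have dimU1 : (\dim U).+1 = k by rewrite dimU.
have := hyperplane_minors dimU1 (vanish _ _ _ cq c'q) (vanish _ _ _ er e'r) i j.
rewrite -!(@mulrz_nat R) -!rmorphB -!rmorphM /=.
move/eqP; rewrite eqr_int => /eqP; rewrite !natz => H; exact: H.
Qed.

(** * A generator of all differences of factorizations *)

Definition difference_multiple {k : nat} (z z' c c' : expo k) (n : int) : Prop :=
  forall i, (c i)%:Z - (c' i)%:Z = n * ((z i)%:Z - (z' i)%:Z).

Lemma difference_multiple_sym {k : nat} {z z' c c' : expo k} {n : int} :
  difference_multiple z z' c c' n -> difference_multiple z z' c' c (- n).
Proof. by move=> H i; rewrite mulNr -H opprB. Qed.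

Lemma difference_multiple_swap {k : nat} {z z' c c' : expo k} {n : int} :
  difference_multiple z z' c c' n -> difference_multiple z' z c c' (- n).
Proof. by move=> H i; rewrite H mulNr -mulrN opprB. Qed.

Lemma difference_multiple0 {k : nat} {z z' c c' : expo k} :
  difference_multiple z z' c c' 0 -> c = c'.
Proof. by move=> H; apply/ffunP => i; have /eqP := H i; rewrite mul0r subr_eq0 => /eqP[]. Qed.

Definition exponents_disjoint {k : nat} (z z' : expo k) : Prop :=
  forall i, z i = 0%N \/ z' i = 0%N.

(** Where [z i > 0], disjointness gives [z' i = 0], hence [c i >= n * z i >= z i]. *)
Lemma difference_multiple_le {k : nat} {z z' c c' : expo k} {n : int} :
  exponents_disjoint z z' -> difference_multiple z z' c c' n -> 0 < n -> expo_le z c.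
Proof.
move=> dis H n0; apply/forallP => i; have := H i.
by case: (dis i) => ->; nia.
Qed.

Lemma exponents_disjoint_sym {k : nat} {z z' : expo k} :
  exponents_disjoint z z' -> exponents_disjoint z' z.
Proof. by move=> dis i; case: (dis i); [right|left]. Qed.

Definition difference_generator {m k : nat} (N : nilop m) (p : 'I_k -> 'Z_m)
    (z z' : expo k) : Prop :=
  forall q c c', factorizations N p (Some q) c -> factorizations N p (Some q) c' ->
    exists n, difference_multiple z z' c c' n.

Lemma difference_generator_sym {m k : nat} {N : nilop m} {p : 'I_k -> 'Z_m}
    {z z' : expo k} :
  difference_generator N p z z' -> difference_generator N p z' z.
Proof.
move=> gen q c c' cq c'q; have [n nP] := gen q c c' cq c'q.
by exists (- n); apply: difference_multiple_swap.
Qed.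

(** Total degree of a pair: the generator minimizes it, and the descent to the generator is an
    induction on it. *)
Definition size2 {k : nat} (c c' : expo k) : nat := (\sum_i (c i + c' i))%N.

Lemma size2D {k : nat} (c c' g g' : expo k) :
  size2 (c + g) (c' + g') = (size2 c c' + size2 g g')%N.
Proof. by rewrite /size2 -big_split; apply: eq_bigr => i _ /=; rewrite !ffunE addnACA. Qed.

Lemma size2_gt0 {k : nat} {c c' : expo k} : c <> c' -> (0 < size2 c c')%N.
Proof.
move=> cc'; rewrite lt0n sum_nat_eq0; apply/negP => /forallP H; apply: cc'.
by apply/ffunP => i; have := H i; rewrite addn_eq0 => /andP[/eqP -> /eqP ->].
Qed.

Lemma disjoint_absz (a b : nat) : a = 0%N \/ b = 0%N -> `|a%:Z - b%:Z| = (a + b)%N :> int.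
Proof. by case=> ->; lia. Qed.

(** [C] and [V] are the differences at a reference coordinate. Proportionality makes
    [C * V * (c - c') * (z - z')] equal to the square of [C * (z - z')], so the two differences do
    not have opposite signs. *)
Lemma same_sign_nested (C V : int) (c c' z z' : nat) :
  c = 0%N \/ c' = 0%N -> z = 0%N \/ z' = 0%N -> 
  (c%:Z - c'%:Z) * V = C * (z%:Z - z'%:Z) -> 0 < C * V -> (z + z' <= c + c')%N ->
  (z <= c)%N && (z' <= c')%N.
Proof.
move=> dc dz H CV le.
have sign : 0 <= (c%:Z - c'%:Z) * (z%:Z - z'%:Z).
  have e (a b : int) : C * V * (a * b) = C * b * (a * V) by ring.
  by rewrite -(pmulr_rge0 _ CV) e H -expr2 sqr_ge0.
case: dc dz sign le => -> [] -> sign le; apply/andP; split; try lia.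
- have [->//|z0] := posnP z; have : (0 < c')%N by lia.
  by nia.
all: have [->//|z0] := posnP z'; have : (0 < c)%N by lia.
by nia.
Qed.

(** For disjoint pairs the absolute differences are the sums [z + z'] and [c + c'], again
    proportional. Comparing sizes bounds [z + z'] by [c + c'] in each coordinate, and the sign of
    the ratio decides which way the pairs nest. *)
Lemma proportional_nested {k : nat} {z z' c c' : expo k} :
  exponents_disjoint z z' -> exponents_disjoint c c' -> z <> z' -> c <> c' ->
  (size2 z z' <= size2 c c')%N ->
  (forall i j, ((c i)%:Z - (c' i)%:Z) * ((z j)%:Z - (z' j)%:Z) =
               ((c j)%:Z - (c' j)%:Z) * ((z i)%:Z - (z' i)%:Z)) ->
  (expo_le z c && expo_le z' c') || (expo_le z c' && expo_le z' c).
Proof.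
move=> dz dc zz' cc' le_size prop.
have [i0 zi0] : exists i, z i <> z' i.
  apply: contrapT => nE; apply: zz'; apply/ffunP => i.
  by apply: contrapT => zi; apply: nE; exists i.
have [i1 ci1] : exists i, c i <> c' i.
  apply: contrapT => nE; apply: cc'; apply/ffunP => i.
  by apply: contrapT => ci; apply: nE; exists i.
have propn i j : ((c i + c' i) * (z j + z' j) = (c j + c' j) * (z i + z' i))%N.
  by apply/eqP; rewrite -eqz_nat !PoszM -!disjoint_absz // -!normrM prop.
have z_gt0 : (0 < z i0 + z' i0)%N by lia.
have c_gt0 : (0 < c i0 + c' i0)%N.
  have c1_gt0 : (0 < c i1 + c' i1)%N by lia.
  by have := propn i0 i1; nia.
(* A ratio below one at [i0] would bound [c + c'] by [z + z'] everywhere and contradict the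
   comparison of sizes. *)
have le0 : (z i0 + z' i0 <= c i0 + c' i0)%N.
  rewrite leqNgt; apply/negP => lt0; move: le_size; rewrite leqNgt => /negP; apply.
  rewrite /size2 (bigD1 i0) //= [ltnRHS](bigD1 i0) //=.
  rewrite -addSn leq_add // leq_sum // => i _.
  by have := propn i i0; nia.
have le i : (z i + z' i <= c i + c' i)%N by have := propn i i0; nia.
have : ((c i0)%:Z - (c' i0)%:Z) * ((z i0)%:Z - (z' i0)%:Z) != 0.
  by rewrite mulf_neq0 // -normr_gt0 disjoint_absz.
rewrite neq_lt => /orP[neg|pos]; apply/orP; [right|left].
  suff nested i : (z i <= c' i)%N && (z' i <= c i)%N.
    by apply/andP; split; apply/forallP => i; case/andP: (nested i).
  apply: (@same_sign_nested ((c' i0)%:Z - (c i0)%:Z) ((z i0)%:Z - (z' i0)%:Z)) => //.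
  - exact: exponents_disjoint_sym.
  - by rewrite -opprB mulNr prop -mulNr opprB.
  - by rewrite -opprB mulNr oppr_gt0.
  - by rewrite [leqRHS]addnC.
suff nested i : (z i <= c i)%N && (z' i <= c' i)%N.
  by apply/andP; split; apply/forallP => i; case/andP: (nested i).
exact: (@same_sign_nested ((c i0)%:Z - (c' i0)%:Z) ((z i0)%:Z - (z' i0)%:Z)).
Qed.

(** Descent: a pair sharing an atom loses it without changing its difference. A disjoint pair is at
    least as large as the minimal one, hence contains it by proportionality; removing it changes the
    multiple by one. *)
Lemma exists_difference_generator {R : realType} {m k d : nat} {N : nilop m}
    {p : 'I_k -> 'Z_m} {xi : 'Z_m -> R} :
  generic_point N xi -> atom_enum N p -> cone_dim (FN (R := R) N p) d -> d.+1 = k ->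
  exists b z z', [/\ factorizations N p (Some b) z, factorizations N p (Some b) z',
    z <> z', exponents_disjoint z z' & difference_generator N p z z'].
Proof.
move=> xiN pA dimF dk.
pose P n := `[< exists q c c', [/\ factorizations N p (Some q) c,
  factorizations N p (Some q) c', c <> c' & size2 c c' = n] >].
have exP : exists n, P n.
  have [|q [c [c' [cq c'q cc']]]] := exists_two_factorizations xiN pA dimF; first by lia.
  by exists (size2 c c'); apply/asboolP; exists q, c, c'.
case: (ex_minnP exP) => n0 /asboolP[b [z [z' [zb z'b zz' zn]]]] n0_min.
have size2_unit i : (0 < size2 (@expo_unit k i) (expo_unit i))%N.
  by rewrite /size2 (bigD1 i) //= !ffunE eqxx.
have cancel_common q c c' i : factorizations N p (Some q) c -> factorizations N p (Some q) c' ->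
    (0 < c i)%N -> (0 < c' i)%N -> exists r g g', [/\ c = g + expo_unit i,
      c' = g' + expo_unit i, factorizations N p (Some r) g & factorizations N p (Some r) g'].
  move=> cq c'q; rewrite -!expo_le_unit => /expo_leP[g cg] /expo_leP[g' cg'].
  rewrite cg in cq; rewrite cg' in c'q.
  have ui := factorizations_unit (p := p) xiN i.
  by have [r [gr g'r]] := factorizations_cancel xiN cq c'q ui ui; exists r, g, g'.
(* Cancelling a shared atom would give a smaller pair of distinct factorizations. *)
have dis : exponents_disjoint z z'.
  move=> i; apply: contrapT => /not_orP[/eqP]; rewrite -lt0n => zi /eqP; rewrite -lt0n => z'i.
  have [r [g [g' [zg z'g gr g'r]]]] := cancel_common b z z' i zb z'b zi z'i.
  have := n0_min (size2 g g'); rewrite -zn zg z'g size2D  => le_g.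
  suff /le_g : P (size2 g g') by have := size2_unit i; lia.
  by apply/asboolP; exists r, g, g'; split=> // e; apply: zz'; rewrite zg z'g e.
exists b, z, z'; split=> // q c c'.
have [n] := ubnP (size2 c c'); elim: n q c c' => // n IHn q c c' cn cq c'q.
have [->|/eqP cc'] := eqVneq c c'.
  by exists 0 => i; rewrite mul0r subrr.
have [[i [ci c'i]]|nocommon] := pselect (exists i, (0 < c i)%N /\ (0 < c' i)%N).
  have [r [g [g' [cg c'g gr g'r]]]] := cancel_common q c c' i cq c'q ci c'i.
  have [|t tP] := IHn r g g' _ gr g'r.
    by move: cn; rewrite cg c'g size2D; have := size2_unit i; lia.
  by exists t => j; rewrite -tP cg c'g !expo_addE; lia.
have disc : exponents_disjoint c c'.
  move=> i; case: (posnP (c i)) => [|ci]; first by left.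
  by case: (posnP (c' i)) => [|c'i]; [right | case: nocommon; exists i].
have big_c : (size2 z z' <= size2 c c')%N.
  by rewrite zn; apply: n0_min; apply/asboolP; exists q, c, c'.
have prop := factorizations_proportional dimF dk cq c'q zb z'b.
case/orP: (proportional_nested dis disc zz' cc' big_c prop) => /andP[].
  move=> /expo_leP[g cg] /expo_leP[g' c'g].
  rewrite cg in cq; rewrite c'g in c'q.
  have [r [gr g'r]] := factorizations_cancel xiN cq c'q zb z'b.
  have [|t tP] := IHn r g g' _ gr g'r.
    by move: cn (size2_gt0 zz'); rewrite cg c'g size2D; lia.
  by exists (t + 1) => i; rewrite mulrDl -tP cg c'g !expo_addE mul1r; lia.
(* Here [z'] lies below [c] and [z] below [c'], so the multiple drops by one. *)
move=> /expo_leP[g c'g] /expo_leP[g' cg].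
rewrite cg in cq; rewrite c'g in c'q.
have [r [g'r gr]] := factorizations_cancel xiN cq c'q z'b zb.
have [|t tP] := IHn r g' g _ g'r gr.
  by move: cn (size2_gt0 (nesym zz')); rewrite cg c'g size2D; lia.
by exists (t - 1) => i; rewrite mulrBl -tP cg c'g !expo_addE mul1r; lia.
Qed.

(** If [z = 0] then [b = 0], whose only factorization is [0] since atoms have positive weight. *)
Lemma factorization_gt0 {R : realType} {m k : nat} {N : nilop m} {p : 'I_k -> 'Z_m}
    {xi : 'Z_m -> R} {b : 'Z_m} {z z' : expo k} :
  generic_point N xi -> atom_enum N p ->
  factorizations N p (Some b) z -> factorizations N p (Some b) z' -> z <> z' ->
  exists i, (0 < z i)%N.
Proof.
move=> xiN pA zb z'b zz'; apply: contrapT => z_eq0.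
have z0 : z = 0.
  apply/ffunP => i; rewrite ffunE; case: (posnP (z i)) => // zi.
  by case: z_eq0; exists i.
have [b0 _] := (factorizationsP xiN _ _).1 zb.
rewrite z0 zbar0 in b0.
by apply: zz'; rewrite z0 (factorizations_eq0 xiN z'b (atom_enum_neq0 pA)).
Qed.

(** * Trading [z] for [z']: the Betti element and the chains of factorizations *)

Section Trades.
Context {R : realType} {m k : nat} {N : nilop m} {p : 'I_k -> 'Z_m} {xi : 'Z_m -> R}.
Context {b : 'Z_m} {z z' : expo k}.
Hypothesis xiN : generic_point N xi.
Hypothesis pA : atom_enum N p.
Hypothesis zb : factorizations N p (Some b) z.
Hypothesis z'b : factorizations N p (Some b) z'.
Hypothesis zz' : z <> z'.
Hypothesis dis : exponents_disjoint z z'.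
Hypothesis gen : difference_generator N p z z'.

(** Trading [z] for [z'] lowers a coordinate in the support of [z], so it must stop. Two results
    would differ by a multiple of [z - z'], and a nonzero one would put [z] below one of them. *)
Lemma exists_avoiding q :
  exists w, unique (fun v => factorizations N p (Some q) v /\ ~~ expo_le z v) w.
Proof.
have [i zi] := factorization_gt0 xiN pA zb z'b zz'.
have z'i : z' i = 0%N by case: (dis i) => // zi0; rewrite zi0 in zi.
have [w [wq zw]] : exists w, factorizations N p (Some q) w /\ ~~ expo_le z w.
  have [w] := exists_factorization xiN q pA.
  have [n] := ubnP (w i); elim: n w => // n IHn w wn wq.
  have [/expo_leP[g wg]|] := boolP (expo_le z w); last by exists w.
  rewrite wg addrC in wq; have := factorizations_swap xiN wq zb z'b.
  by apply: IHn; move: wn; rewrite wg !expo_addE; lia.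
exists w; split=> // v [vq zv].
have [n nP] := gen q w v wq vq.
have [n_gt0|n_lt0|n0] := ltrgtP n 0.
- by move: zv; rewrite (difference_multiple_le dis (difference_multiple_sym nP)) ?oppr_gt0.
- by move: zw; rewrite (difference_multiple_le dis nP).
by rewrite n0 in nP; apply: difference_multiple0 nP.
Qed.

(** A trade turns [g + z] into [z' + g]. As [q <> b], the common part [g] is nonzero, so the two
    overlap. *)
Lemma trade_connected {q} (n : nat) {c c'} : q <> b ->
  factorizations N p (Some q) c -> factorizations N p (Some q) c' ->
  difference_multiple z z' c c' n ->
  exists s, [/\ path (@overlap k) c s,
    forall v, v \in s -> factorizations N p (Some q) v & last c s = c'].
Proof.
move=> qb; elim: n c => [|n IHn] c cq c'q nP.
  by exists [::]; split=> //; apply: difference_multiple0 nP.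
have /expo_leP[g cg] := difference_multiple_le dis nP isT.
have gz'q : factorizations N p (Some q) (z' + g).
  by apply: (factorizations_swap xiN _ zb z'b); rewrite addrC -cg.
have [|s [gs sq s_last]] := IHn (z' + g) gz'q c'q.
  by move=> i; have := nP i; rewrite cg !expo_addE; lia.
exists (z' + g :: s); split=> [||//] /=; last first.
  by move=> v; rewrite inE => /orP[/eqP-> //|]; apply: sq.
rewrite gs andbT; have [i gi] : exists i, (0 < g i)%N.
  apply: contrapT => g0; apply: qb.
  have {}g0 : g = 0.
    apply/ffunP => i; rewrite ffunE; case: (posnP (g i)) => // gi.
    by case: g0; exists i.
  have [<- _] := (factorizationsP xiN _ _).1 cq.
  by have [<- _] := (factorizationsP xiN _ _).1 zb; rewrite cg g0 add0r.
by apply/existsP; exists i; rewrite cg !expo_addE !addn_gt0 gi orbT.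
Qed.

(** A factorization is [z + n (z - z')]. Nonnegativity on the support of [z] forces [n >= -1], and
    on that of [z'] it forces [n <= 0]. *)
Lemma betti_factorizations : factorizations N p (Some b) = [set z; z'].
Proof.
apply/seteqP; split=> [c cb|c [->|->] //].
have [i zi] := factorization_gt0 xiN pA zb z'b zz'.
have [j z'j] := factorization_gt0 xiN pA z'b zb (nesym zz').
have [n nP] := gen b c z cb zb.
have n_ge : - 1 <= n.
  by have := nP i; have -> : z' i = 0%N by [case: (dis i) => // zi0; rewrite zi0 in zi]; nia.
have n_le : n <= 0.
  by have := nP j; have -> : z j = 0%N by [case: (dis j) => // zj0; rewrite zj0 in z'j]; nia.
have [n0|n1] : n = 0 \/ n = -1 by lia.
  by left; rewrite n0 in nP; apply: difference_multiple0 nP.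
by right; apply/ffunP => l; have := nP l; rewrite n1 mulN1r opprB => /addIr [].
Qed.

Lemma betti_disconnected : inner_betti N p b.
Proof.
move=> /(_ z z' zb z'b)[s]; rewrite betti_factorizations => -[zs sB s_last].
(* A path starting at [z] can never step to [z'], as their supports are disjoint. *)
have : last z s = z.
  elim: s zs sB {s_last} => //= v s IHs /andP[zv vs] sB.
  have vz : v = z.
    case: (sB v); rewrite ?mem_head // => vz'; case/existsP: zv => i /andP[zi].
    by rewrite vz'; case: (dis i) => e; rewrite e // in zi *.
  by rewrite vz in vs *; apply: IHs => // w ws; apply: sB; rewrite inE ws orbT.
by rewrite s_last => /nesym.
Qed.

End Trades.

(** For [q <> b], trades join any two factorizations; the sign of the multiple tells in which
    direction to trade. *)
Lemma inner_betti_unique {R : realType} {m k : nat} {N : nilop m} {p : 'I_k -> 'Z_m}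
    {xi : 'Z_m -> R} {b q : 'Z_m} {z z' : expo k} :
  generic_point N xi ->
  factorizations N p (Some b) z -> factorizations N p (Some b) z' ->
  exponents_disjoint z z' -> difference_generator N p z z' -> inner_betti N p q -> b = q.
Proof.
move=> xiN zb z'b dis gen; apply: contra_notP => /nesym qb c c' cq c'q.
have [n nP] := gen q c c' cq c'q.
have [n_ge0|n_lt0] := leP 0 n.
  apply: (trade_connected xiN zb z'b dis `|n|%N qb cq c'q).
  by move=> i; rewrite nP; congr (_ * _); lia.
apply: (trade_connected xiN z'b zb (exponents_disjoint_sym dis) `|n|%N qb cq c'q).
by move=> i; have := difference_multiple_swap nP i => ->; congr (_ * _); lia.
Qed.

Lemma betti_divides {R : realType} {m k : nat} {N : nilop m} {p : 'I_k -> 'Z_m}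
    {xi : 'Z_m -> R} {b : 'Z_m} {z : expo k} (q : 'Z_m) :
  generic_point N xi -> atom_enum N p -> factorizations N p (Some b) z ->
  (exists r, Some q = N (Some b) r) <->
  exists g, factorizations N p (Some q) (g + z).
Proof.
move=> xiN pA zb; have [b_bar b_wt] := (factorizationsP xiN _ _).1 zb.
split=> [[s /esym/(generic_nilop_Some xiN)[a [r [[<-] _ br w]]]]|[g gz]].
  have [g /(factorizationsP xiN)[er wr]] := exists_factorization xiN r pA.
  exists g; apply/(factorizationsP xiN).
  by rewrite zbarD dotD er wr b_bar b_wt addrC br addrC w.
exists (Some (zbar p g)); apply/esym/(generic_nilop_Some xiN).
exists b, (zbar p g); have := factorizations_divisor xiN gz.
move: gz; rewrite !(factorizationsP xiN) zbarD dotD b_bar b_wt => -[<- <-] [_ ->].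
by split; rewrite // addrC.
Qed.

(** If [w = w'] and [g + z] factors [q], write [w - (g + z)] as [n (z - z')]. Then [n >= 0] puts [z]
    below [w], and [n < 0] puts [z'] below it. Conversely, if [w'] avoids [z] as well, uniqueness
    gives [w = w']. *)
Lemma avoiding_eq {R : realType} {m k : nat} {N : nilop m} {p : 'I_k -> 'Z_m}
    {xi : 'Z_m -> R} {b q : 'Z_m} {z z' w w' : expo k} :
  generic_point N xi -> atom_enum N p ->
  factorizations N p (Some b) z -> factorizations N p (Some b) z' ->
  exponents_disjoint z z' -> difference_generator N p z z' ->
  unique (fun v => factorizations N p (Some q) v /\ ~~ expo_le z v) w ->
  unique (fun v => factorizations N p (Some q) v /\ ~~ expo_le z' v) w' ->
  w <> w' <-> exists r : option 'Z_m, Some q = N (Some b) r.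
Proof.
move=> xiN pA zb z'b dis gen [[wq zw] w_uniq] [[w'q z'w'] w'_uniq].
rewrite (betti_divides q xiN pA zb); split=> [ww'|[g gz] e].
  have [/expo_leP[g w'g]|zw'] := boolP (expo_le z w'); first by exists g; rewrite -w'g.
  by case: ww'; apply: w_uniq.
rewrite -e in z'w' => {e}.
have [n nP] := gen q w (g + z) wq gz.
have [n_gt0|n_lt0|n0] := ltrgtP 0 n.
- by move: zw; rewrite (difference_multiple_le dis nP).
- move: z'w'; rewrite (difference_multiple_le (exponents_disjoint_sym dis)
    (difference_multiple_swap nP)) //.
  by rewrite oppr_gt0.
- rewrite -n0 in nP; move/negP: zw; apply; apply/expo_leP; exists g.
  exact: difference_multiple0 nP.
Qed.

(** * Assembly of (a), (b) and (c) *)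

Theorem theorem5p5 (R : realType) (m : nat) (m_gt1 : (1 < m)%N) (N : nilop m)
    (N_kunz : kunz_nilsemigroup R N)
    (k : nat) (p : 'I_k -> 'Z_m) (p_atoms : atom_enum N p)
    (dim_FN : exists2 d, cone_dim (FN (R := R) N p) d & d.+1 = k)
    (FN_boundary : ~ (FN N p `<=` boundary (CmA (R := R) p))) :
  exists (b : 'Z_m) (z z' : {ffun 'I_k -> nat}),
    (* (a) *)
    [/\ unique (inner_betti N p) b, z <> z'
      & factorizations N p (Some b) = [set z; z']] /\
    (* (b) *)
    (forall q : 'Z_m, exists w w' : {ffun 'I_k -> nat},
      [/\ unique (fun v => factorizations N p (Some q) v /\ ~~ expo_le z v) w,
          unique (fun v => factorizations N p (Some q) v /\ ~~ expo_le z' v) w'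
        & w <> w' <-> exists r : option 'Z_m, Some q = N (Some b) r]) /\
    (* (c) *)
    (forall N' : nilop m, kunz_nilsemigroup R N' -> atom_enum N' p ->
      staircase N' p -> FN (R := R) N p `<=` FN N' p ->
      (forall (q : 'Z_m) w, factorizations N' p (Some q) w -> ~~ expo_le z w) \/
      (forall (q : 'Z_m) w, factorizations N' p (Some q) w -> ~~ expo_le z' w)).
Proof.
have [d dimF dk] := dim_FN.
have [xi xiN] := exists_generic_point N m_gt1 N_kunz.
have [b [z [z' [zb z'b zz' dis gen]]]] := exists_difference_generator xiN p_atoms dimF dk.
have dis' := exponents_disjoint_sym dis.
have gen' := difference_generator_sym gen.
exists b, z, z'; split; last split.
- split=> //; last exact: betti_factorizations xiN p_atoms zb z'b zz' dis gen.
  split; first exact: betti_disconnected xiN p_atoms zb z'b zz' dis gen.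
  by move=> q; exact: inner_betti_unique xiN zb z'b dis gen.
- move=> q.
  have [w wP] := exists_avoiding xiN p_atoms zb z'b zz' dis gen q.
  have [w' w'P] := exists_avoiding xiN p_atoms z'b zb (nesym zz') dis' gen' q.
  by exists w, w'; split=> //; exact: avoiding_eq xiN p_atoms zb z'b dis gen wP w'P.
move=> N' N'_kunz _ N'_st _.
have [xi' xi'N'] := exists_generic_point N' m_gt1 N'_kunz.
(* A vector below a factorization in [N'] factors its own residue there; for [z] and [z'] this
   residue is [b]. *)
have divides q v w : factorizations N' p (Some q) w -> expo_le v w ->
    factorizations N' p (Some (zbar p v)) v.
  move=> wq /expo_leP[g wg]; apply: (factorizations_divisor xi'N' (q := q) (d := g)).
  by rewrite addrC -wg.
apply: contrapT => /not_orP[] /existsNP[q /existsNP[w /not_implyP[wq /negP/negPn zw]]].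
move=> /existsNP[r /existsNP[w' /not_implyP[w'r /negP/negPn z'w']]].
apply: zz'; apply: (staircase_unique xi'N' N'_st (divides _ _ _ wq zw) (divides _ _ _ w'r z'w')).
have [-> _] := (factorizationsP xiN _ _).1 zb.
by have [-> _] := (factorizationsP xiN _ _).1 z'b.
Qed.
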